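(* There exist universal constants $K,C>0$ and a first-order method with the following property. Consider any problem $\min_x F(x)=g(x)+h(c(x))$ as described in the context, a real $\|\nabla c\|$ with $\sup_{x\in\operatorname{dom} g}\|\nabla c(x)\|_{\rm op}\le\|\nabla c\|<\infty$, a point $x_0\in\operatorname{dom} g$, and a target accuracy $\varepsilon>0$, and suppose that $\inf F>-\infty$ and that each of the quantities $\|\nabla c\|$, $L$, $\beta$, $F(x_0)-\inf F$, $1/\varepsilon$ is at least $K$. Then the method, started at $x_0$, generates a point $x$ satisfying $\|\mathcal{G}_{1/\mu}(x)\|\le\varepsilon$, where $\mu=L\beta$, after at most $$C\cdot\frac{L^2\beta\|\nabla c\|\cdot\big(F(x_0)-\inf F\big)}{\varepsilon^3}\,\log\left(\frac{\|\nabla c\|L}{\varepsilon}\right)$$ basic operations.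
   Context: Setting: $g\colon\mathbf{R}^d\to\mathbf{R}\cup\{+\infty\}$ is proper, closed and convex; $h\colon\mathbf{R}^m\to\mathbf{R}$ is convex and $L$-Lipschitz continuous; $c\colon\mathbf{R}^d\to\mathbf{R}^m$ is $C^1$-smooth with $\|\nabla c(x)-\nabla c(y)\|_{\rm op}\le\beta\|x-y\|$ for all $x,y$. Set $\mu:=L\beta$ and $F(x):=g(x)+h(c(x))$. For $t>0$ define $F_t(z;y):=g(z)+h\big(c(y)+\nabla c(y)(z-y)\big)+\frac{1}{2t}\|z-y\|^2$, $S_t(y):=\operatorname{argmin}_z F_t(z;y)$, and the prox-gradient $\mathcal{G}_t(x):=t^{-1}(x-S_t(x))$. Proximal maps: $\operatorname{prox}_{tf}(x):=\operatorname{argmin}_z\{f(z)+\frac{1}{2t}\|z-x\|^2\}$. The functions $g$ and $h$ are prox-friendly, meaning that $\operatorname{prox}_{tg}$ and $\operatorname{prox}_{th}$ can be evaluated for all $t>0$. A basic operation is an evaluation of $c(x)$, a matrix-vector product $\nabla c(x)v$ or $\nabla c(x)^*w$, or an evaluation of $\operatorname{prox}_{th}$ or $\operatorname{prox}_{tg}$. The method has access to the problem only through basic operations (and ordinary vector arithmetic), together with the values $L$, $\beta$, $\|\nabla c\|$, $\varepsilon$. *)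

(* Defs.v *)
From HB Require Import structures.
From mathcomp Require Import all_boot all_order all_algebra.
From mathcomp Require Import all_classical all_reals all_analysis.

Set Implicit Arguments.
Unset Strict Implicit.
Unset Printing Implicit Defensive.

Import Order.TTheory GRing.Theory Num.Theory.
Import numFieldNormedType.Exports.

Local Open Scope classical_set_scope.
Local Open Scope ring_scope.

(* R^n is 'rV[R]_n. The library's norm `|x| on 'rV[R]_n is the sup norm, so the
   Euclidean structure is introduced here; the topology is the same, hence the
   library's [closed], [continuous] and [differentiable] apply unchanged. *)

Definition dotv (R : realType) (n : nat) (u v : 'rV[R]_n) : R :=
  \sum_i u 0 i * v 0 i.

Definition enorm (R : realType) (n : nat) (v : 'rV[R]_n) : R :=
  Num.sqrt (dotv v v).

(* Matrices act on row vectors from the right: with A := jacobian c x, the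
   vector nabla c(x) v is [v *m A] and nabla c(x)^* w is [w *m A^T]. *)
Definition opnorm (R : realType) (n m : nat) (A : 'M[R]_(n, m)) : R :=
  sup [set enorm (v *m A) | v in [set v : 'rV[R]_n | enorm v <= 1]].

Section ProblemClass.
Context {R : realType} {d m : nat}.
Implicit Types (g : 'rV[R]_d -> \bar R) (h : 'rV[R]_m -> R)
  (c : 'rV[R]_d -> 'rV[R]_m).

Definition edom g : set 'rV[R]_d := [set x | (g x < +oo)%E].

Definition proper_function g : Prop := edom g !=set0 /\ forall x, (-oo < g x)%E.

Definition epigraph g : set ('rV[R]_d * R) := [set p | (g p.1 <= p.2%:E)%E].

Definition closed_function g : Prop := closed (epigraph g).

(* For g > -oo the right-hand side is never of the form +oo - oo; at t = 0 and
   t = 1 the convention 0 * +oo = 0 makes the inequality trivial. *)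
Definition econvex g : Prop := forall (x y : 'rV[R]_d) (t : R), 0 <= t <= 1 ->
  (g (t *: x + (1 - t) *: y)%R <= t%:E * g x + (1 - t)%:E * g y)%E.

Definition elipschitz (L : R) h : Prop :=
  forall y1 y2, `|h y1 - h y2| <= L * enorm (y1 - y2).

Definition C1_smooth c : Prop :=
  (forall x, differentiable c x) /\ continuous (fun x => jacobian c x).

Definition jacobian_lipschitz (beta : R) c : Prop :=
  forall x y, opnorm (jacobian c x - jacobian c y) <= beta * enorm (x - y).

Definition composite g h c (x : 'rV[R]_d) : \bar R := (g x + (h (c x))%:E)%E.

End ProblemClass.

Section ProxOperators.
Context {R : realType}.

Definition argmin (n : nat) (f : 'rV[R]_n -> \bar R) : set 'rV[R]_n :=
  [set z | forall w, (f z <= f w)%E].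

(* [argmin f] as a point; 0 if there is no minimizer. It is only used for
   strongly convex closed proper f, which have exactly one minimizer. *)
Definition argmin_pt (n : nat) (f : 'rV[R]_n -> \bar R) : 'rV[R]_n :=
  xget 0 (argmin f).

Definition prox (n : nat) (t : R) (f : 'rV[R]_n -> \bar R) (x : 'rV[R]_n) :
    'rV[R]_n :=
  argmin_pt (fun z => (f z + ((2 * t)^-1 * enorm (z - x) ^+ 2)%:E)%E).

Context {d m : nat}.
Implicit Types (g : 'rV[R]_d -> \bar R) (h : 'rV[R]_m -> R)
  (c : 'rV[R]_d -> 'rV[R]_m).

Definition prox_linear_model g h c (t : R) (z y : 'rV[R]_d) : \bar R :=
  (g z + (h (c y + (z - y) *m jacobian c y)%R)%:E
       + ((2 * t)^-1 * enorm (z - y) ^+ 2)%:E)%E.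

Definition prox_linear_step g h c (t : R) (y : 'rV[R]_d) : 'rV[R]_d :=
  argmin_pt (fun z => prox_linear_model g h c t z y).

Definition prox_gradient g h c (t : R) (x : 'rV[R]_d) : 'rV[R]_d :=
  t^-1 *: (x - prox_linear_step g h c t x).

End ProxOperators.

(* A first-order method is a finite program over three banks of registers:
   scalars, vectors of R^d and vectors of R^m. The syntax mentions neither d, m
   nor the problem data: vectors are touched only through basic operations,
   linear combinations and inner products. *)

(* [SDotD i j] and [SDotM i j] are the inner products of registers i and j of
   the R^d bank and of the R^m bank. *)
Inductive sexpr : Type :=
| SReg of nat
| SNat of nat
| SAdd of sexpr & sexpr
| SSub of sexpr & sexpr
| SMul of sexpr & sexpr
| SDiv of sexpr & sexpr
| SSqrt of sexpr
| SDotD of nat & nat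
| SDotM of nat & nat.

Inductive vexpr : Type :=
| VReg of nat
| VAdd of vexpr & vexpr
| VScale of sexpr & vexpr.

(* The target register comes first. [EvalC y x] stores c(x), [EvalJ y x v]
   stores nabla c(x) v, [EvalJT u x w] stores nabla c(x)^* w, [ProxG u t x]
   stores prox_{tg}(x) and [ProxH u t y] stores prox_{th}(y). The guard of [If]
   and [While] is the comparison e1 <= e2. *)
Inductive method : Type :=
| Skip
| SetS of nat & sexpr
| SetD of nat & vexpr
| SetM of nat & vexpr
| EvalC of nat & nat
| EvalJ of nat & nat & nat
| EvalJT of nat & nat & nat
| ProxG of nat & sexpr & nat
| ProxH of nat & sexpr & nat
| Seq of method & method
| If of sexpr & sexpr & method & method
| While of sexpr & sexpr & method.

Record state (R : realType) (d m : nat) : Type := State {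
  sreg : nat -> R;
  dreg : nat -> 'rV[R]_d;
  mreg : nat -> 'rV[R]_m }.

Section Semantics.
Context {R : realType} {d m : nat}.
Variables (g : 'rV[R]_d -> \bar R) (h : 'rV[R]_m -> R)
  (c : 'rV[R]_d -> 'rV[R]_m).
Implicit Types s : state R d m.

Fixpoint seval s (e : sexpr) : R :=
  match e with
  | SReg i => sreg s i
  | SNat n => n%:R
  | SAdd a b => seval s a + seval s b
  | SSub a b => seval s a - seval s b
  | SMul a b => seval s a * seval s b
  | SDiv a b => seval s a / seval s b
  | SSqrt a => Num.sqrt (seval s a)
  | SDotD i j => dotv (dreg s i) (dreg s j)
  | SDotM i j => dotv (mreg s i) (mreg s j)
  end.

Fixpoint veval (V : lmodType R) (bank : nat -> V) s (e : vexpr) : V :=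
  match e with
  | VReg i => bank i
  | VAdd a b => veval bank s a + veval bank s b
  | VScale a b => seval s a *: veval bank s b
  end.

Definition sets s (i : nat) (a : R) : state R d m :=
  State [eta sreg s with i |-> a] (dreg s) (mreg s).

Definition setd s (i : nat) (x : 'rV[R]_d) : state R d m :=
  State (sreg s) [eta dreg s with i |-> x] (mreg s).

Definition setm s (i : nat) (y : 'rV[R]_m) : state R d m :=
  State (sreg s) (dreg s) [eta mreg s with i |-> y].

(* [exec M s s' k]: run from state s, the method M halts in state s' after
   exactly k basic operations. A proximal map with parameter t <= 0 is stuck. *)
Inductive exec : method -> state R d m -> state R d m -> nat -> Prop :=
| exec_Skip s : exec Skip s s 0
| exec_SetS s i e : exec (SetS i e) s (sets s i (seval s e)) 0
| exec_SetD s i e : exec (SetD i e) s (setd s i (veval (dreg s) s e)) 0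
| exec_SetM s i e : exec (SetM i e) s (setm s i (veval (mreg s) s e)) 0
| exec_EvalC s y x : exec (EvalC y x) s (setm s y (c (dreg s x))) 1
| exec_EvalJ s y x v :
    exec (EvalJ y x v) s (setm s y (dreg s v *m jacobian c (dreg s x))) 1
| exec_EvalJT s u x w :
    exec (EvalJT u x w) s (setd s u (mreg s w *m (jacobian c (dreg s x))^T)) 1
| exec_ProxG s u e x : 0 < seval s e ->
    exec (ProxG u e x) s (setd s u (prox (seval s e) g (dreg s x))) 1
| exec_ProxH s u e y : 0 < seval s e ->
    exec (ProxH u e y) s (setm s u (prox (seval s e) (EFin \o h) (mreg s y))) 1
| exec_Seq M1 M2 s1 s2 s3 k1 k2 :
    exec M1 s1 s2 k1 -> exec M2 s2 s3 k2 -> exec (Seq M1 M2) s1 s3 (k1 + k2)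
| exec_IfTrue e1 e2 M1 M2 s s' k : seval s e1 <= seval s e2 ->
    exec M1 s s' k -> exec (If e1 e2 M1 M2) s s' k
| exec_IfFalse e1 e2 M1 M2 s s' k : ~~ (seval s e1 <= seval s e2) ->
    exec M2 s s' k -> exec (If e1 e2 M1 M2) s s' k
| exec_WhileTrue e1 e2 M s1 s2 s3 k1 k2 : seval s1 e1 <= seval s1 e2 ->
    exec M s1 s2 k1 -> exec (While e1 e2 M) s2 s3 k2 ->
    exec (While e1 e2 M) s1 s3 (k1 + k2)
| exec_WhileFalse e1 e2 M s : ~~ (seval s e1 <= seval s e2) ->
    exec (While e1 e2 M) s s 0.

(* [Nc] is the bound on the operator norm of nabla c known to the method. *)
Definition init_state (L beta Nc eps : R) (x0 : 'rV[R]_d) : state R d m :=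
  State (fun i => nth 0 [:: L; beta; Nc; eps] i)
        (fun i => if i is 0%N then x0 else 0)
        (fun=> 0).

(* The output is what register 0 of the R^d bank holds when the method halts. *)
Definition generates (M : method) (L beta Nc eps : R) (x0 x : 'rV[R]_d)
    (k : nat) : Prop :=
  exists2 s, exec M (init_state L beta Nc eps x0) s k & dreg s 0%N = x.

End Semantics.

(* Main.v *)
Require Import Defs.
From HB Require Import structures.
From mathcomp Require Import all_boot all_order all_algebra.
From mathcomp Require Import all_classical all_reals all_analysis.
From mathcomp Require Import ring lra.

Set Implicit Arguments.
Unset Strict Implicit.
Unset Printing Implicit Defensive.

Import Order.TTheory GRing.Theory Num.Theory.
Import numFieldNormedType.Exports.

Local Open Scope classical_set_scope.
Local Open Scope ring_scope.

(** The method is the prox-linear iteration whose subproblems are solved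
    inexactly, by an accelerated proximal gradient method applied to a smoothing
    of h. Write mu = L beta. The model of F at y is the convex function
    z |-> g(z) + h(c(y) + nabla c(y)(z - y)) + mu/2 |z - y|^2.

    Since nabla c is beta-Lipschitz and h is L-Lipschitz, the model majorizes F
    ([taylor_remainder]); it is also mu-strongly convex. Hence a point that
    nearly minimizes it improves F(y) by about mu/2 |y - z*|^2, where z* is the
    prox-linear point and mu |y - z*| is the norm of the prox-gradient.

    To minimize the model, h is replaced by its Moreau envelope of parameter nu,
    where L^2 nu mu = (eps/16)^2. This moves the model by at most L^2 nu / 2
    ([moreau_le], [moreau_ge]) and makes its composite part Lf-smooth with
    Lf = Nc^2/nu ([smoothed_loss_bounds]); the condition number is
    Lf/mu = (16 Nc L/eps)^2. The accelerated method maintains a weight A such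
    that A times the gap to any competitor w stays below |y - w|^2 / 2
    ([accelerated_step]), and A grows by the factor 1 + tau with
    tau = eps/(16 Nc L). So A > 16/mu after O(X log X) steps, X = Nc L/eps
    ([inner_iterations]), and then the gap to z* is at most mu/32 |y - z*|^2.
    The accuracy is thus relative to the very quantity that controls the
    decrease of F, which is why the logarithm contains neither F(x0) - inf F nor
    a diameter.

    With this relative accuracy, mu |x - y| for the computed point x and
    mu |y - z*| are comparable up to an error eps/16: either mu |x - y| <= eps/2, and then the
    prox-gradient at y is at most eps, or F decreases by eps^2/(20 mu)
    ([prox_linear_progress]). The second case occurs at most
    20 mu (F(x0) - inf F)/eps^2 times, and the bound is the product of the two
    iteration counts. *)

(** * The Euclidean norm and the operator norm *)

Section Euclid.
Context {R : realType} {n : nat}.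
Implicit Types (u v w : 'rV[R]_n) (a : R).

Lemma dotvC u v : dotv u v = dotv v u.
Proof. by apply: eq_bigr => i _; rewrite mulrC. Qed.

Lemma dotvDl u v w : dotv (u + v) w = dotv u w + dotv v w.
Proof. by rewrite /dotv -big_split/=; apply: eq_bigr => i _; rewrite mxE mulrDl. Qed.

Lemma dotvZl a u v : dotv (a *: u) v = a * dotv u v.
Proof. by rewrite /dotv mulr_sumr; apply: eq_bigr => i _; rewrite mxE mulrA. Qed.

Lemma dotvNl u v : dotv (- u) v = - dotv u v.
Proof. by rewrite -scaleN1r dotvZl mulN1r. Qed.

Lemma dotvDr u v w : dotv u (v + w) = dotv u v + dotv u w.
Proof. by rewrite !(dotvC u) dotvDl. Qed.

Lemma dotvZr a u v : dotv u (a *: v) = a * dotv u v.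
Proof. by rewrite !(dotvC u) dotvZl. Qed.

Lemma dotvNr u v : dotv u (- v) = - dotv u v.
Proof. by rewrite !(dotvC u) dotvNl. Qed.

Lemma dotv_ge0 v : 0 <= dotv v v.
Proof. by apply: sumr_ge0 => i _; rewrite -expr2 sqr_ge0. Qed.

Lemma enorm_ge0 v : 0 <= enorm v.
Proof. exact: sqrtr_ge0. Qed.

Lemma enorm_sqr v : enorm v ^+ 2 = dotv v v.
Proof. by rewrite sqr_sqrtr// dotv_ge0. Qed.

Definition dotvE := (enorm_sqr, dotvDl, dotvDr, dotvNl, dotvNr, dotvZl, dotvZr).

Lemma enorm0 : enorm (0 : 'rV[R]_n) = 0.
Proof.
by rewrite /enorm /dotv big1 ?sqrtr0// => i _; rewrite mxE mul0r.
Qed.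

Lemma enormZ a v : enorm (a *: v) = `|a| * enorm v.
Proof.
by rewrite /enorm dotvZl dotvZr mulrA -expr2 sqrtrM ?sqr_ge0// sqrtr_sqr.
Qed.

Lemma enormN v : enorm (- v) = enorm v.
Proof. by rewrite -scaleN1r enormZ normrN1 mul1r. Qed.

Lemma enormB u v : enorm (u - v) = enorm (v - u).
Proof. by rewrite -enormN opprB. Qed.

Lemma enorm_eq0 v : enorm v = 0 -> v = 0.
Proof.
move=> v0; apply/rowP => i; rewrite mxE; apply/eqP.
have /eqP : dotv v v = 0 by rewrite -enorm_sqr v0 expr0n.
rewrite psumr_eq0 => [/allP/(_ i)|j _]; last by rewrite -expr2 sqr_ge0.
by rewrite mem_index_enum => /(_ isT); rewrite /= -expr2 sqrf_eq0.
Qed.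

(** Expand the square of |v| u - |u| v. *)
Lemma cauchy_schwarz u v : dotv u v <= enorm u * enorm v.
Proof.
have [u0|u0] := eqVneq (enorm u) 0.
  by rewrite (enorm_eq0 u0) enorm0 mul0r -(scale0r 0) dotvZl mul0r.
have [v0|v0] := eqVneq (enorm v) 0.
  by rewrite (enorm_eq0 v0) enorm0 mulr0 -(scale0r 0) dotvZr mul0r.
have ugt : 0 < enorm u by rewrite lt_neqAle eq_sym u0 enorm_ge0.
have vgt : 0 < enorm v by rewrite lt_neqAle eq_sym v0 enorm_ge0.
have := dotv_ge0 (enorm v *: u - enorm u *: v).
rewrite (_ : dotv _ _ =
  (2 * (enorm u * enorm v)) * (enorm u * enorm v - dotv u v)).
  by rewrite pmulr_rge0 ?subr_ge0// !mulr_gt0.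
rewrite !dotvE (dotvC v u) -!enorm_sqr; ring.
Qed.

Lemma enormD u v : enorm (u + v) <= enorm u + enorm v.
Proof.
rewrite -(@ler_pXn2r _ 2%N)// ?nnegrE ?addr_ge0 ?enorm_ge0//.
rewrite sqrrD !dotvE (dotvC v u).
by have := cauchy_schwarz u v; lra.
Qed.

Lemma enorm_le_sqr u a : 0 <= a -> enorm u ^+ 2 <= a ^+ 2 -> enorm u <= a.
Proof. by move=> a0; rewrite ler_pXn2r// nnegrE enorm_ge0. Qed.

(** Estimates in the Euclidean norm transfer to the topology, which is given by
    the sup norm `|v|. *)
Lemma mx_norm_le_enorm v : `|v| <= enorm v.
Proof.
rewrite [leLHS]/Num.Def.normr /= mx_normrE; apply/bigmax_leP; split; first exact: enorm_ge0.
move=> [i j] _ /=; rewrite ord1 -(@ler_pXn2r _ 2%N)// ?nnegrE ?enorm_ge0//.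
rewrite enorm_sqr real_normK ?num_real// /dotv (bigD1 j)//= -expr2 lerDl.
by apply: sumr_ge0 => k _; rewrite -expr2 sqr_ge0.
Qed.

End Euclid.

Section MatrixAction.
Context {R : realType} {n m : nat}.
Implicit Types (A : 'M[R]_(n, m)).

Lemma dotv_mul_tr A (v : 'rV[R]_n) (w : 'rV[R]_m) :
  dotv (v *m A) w = dotv v (w *m A^T).
Proof.
have dE k (x y : 'rV[R]_k) : dotv x y = (x *m y^T) 0 0.
  by rewrite mxE; apply: eq_bigr => i _; rewrite mxE.
by rewrite !dE trmx_mul trmxK mulmxA.
Qed.

(** The bound by the Frobenius norm shows that the supremum defining [opnorm] is
    taken over a bounded set. *)
Lemma enorm_mulmx_frob A (v : 'rV[R]_n) :
  enorm (v *m A) <= Num.sqrt (\sum_j enorm (col j A)^T ^+ 2) * enorm v.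
Proof.
have S0 : 0 <= \sum_j enorm (col j A)^T ^+ 2.
  by apply: sumr_ge0 => j _; rewrite sqr_ge0.
apply: enorm_le_sqr; first by rewrite mulr_ge0 ?sqrtr_ge0 ?enorm_ge0.
rewrite exprMn (sqr_sqrtr S0) mulr_suml [leLHS]enorm_sqr.
apply: ler_sum => j _.
have -> : (v *m A) 0 j = dotv v (col j A)^T.
  by rewrite mxE; apply: eq_bigr => i _; rewrite !mxE.
rewrite -expr2 -exprMn mulrC.
rewrite -(real_normK (num_real (dotv _ _))) ler_pXn2r ?nnegrE ?mulr_ge0 ?enorm_ge0//.
rewrite ler_norml cauchy_schwarz andbT lerNl -dotvNl.
by rewrite -(enormN v) cauchy_schwarz.
Qed.

Lemma enorm_mulmx A (v : 'rV[R]_n) : enorm (v *m A) <= opnorm A * enorm v.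
Proof.
have [v0|v0] := eqVneq (enorm v) 0.
  by rewrite (enorm_eq0 v0) mul0mx !enorm0 mulr0.
have vgt : 0 < enorm v by rewrite lt_neqAle eq_sym v0 enorm_ge0.
rewrite -ler_pdivrMr// mulrC.
have -> : (enorm v)^-1 * enorm (v *m A) = enorm ((enorm v)^-1 *: v *m A).
  by rewrite -scalemxAl enormZ ger0_norm// invr_ge0 ltW.
apply: sup_upper_bound.
  split; first by exists (enorm (0 *m A)), 0 => //=; rewrite enorm0.
  exists (Num.sqrt (\sum_j enorm (col j A)^T ^+ 2)) => _ [w /= w1 <-].
  apply: (le_trans (enorm_mulmx_frob A w)).
  by rewrite ler_piMr// sqrtr_ge0.
exists ((enorm v)^-1 *: v) => //=.
by rewrite enormZ ger0_norm ?invr_ge0 ?(ltW vgt)// mulVf.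
Qed.

Lemma opnorm_ge0 A : 0 <= opnorm A.
Proof.
have [/= B|B] := pselect (has_sup [set enorm (v *m A) | v in [set v : 'rV[R]_n | enorm v <= 1]]).
  apply: (le_trans (enorm_ge0 (0 *m A))).
  by apply: sup_upper_bound => //; exists 0 => //=; rewrite enorm0.
by rewrite /opnorm sup_out.
Qed.

End MatrixAction.

Lemma continuous_enorm_sqr {R : realType} n (x : 'rV[R]_n) :
  continuous (fun z : 'rV[R]_n => enorm (z - x) ^+ 2).
Proof.
have -> : (fun z => enorm (z - x) ^+ 2) =
    (fun z : 'rV[R]_n => \sum_(i < n) (z 0 i - x 0 i) ^+ 2).
  apply/funext => z; rewrite enorm_sqr; apply: eq_bigr => i _.
  by rewrite !mxE -expr2.
apply: continuous_big => [|i _]; first exact: add_continuous.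
move=> z; have h : (w 0 i - x 0 i) @[w --> z] --> z 0 i - x 0 i.
  by apply: cvgB; [exact: coord_continuous | exact: cvg_cst].
exact: (cvgM h h).
Qed.

(** * Proximal points of a closed convex function *)

Section Prox.
Context {R : realType} {n : nat}.
Implicit Types (f : 'rV[R]_n -> \bar R) (x y z w p : 'rV[R]_n).

Definition proper_closed_convex f : Prop :=
  [/\ proper_function f, closed_function f & econvex f].

Lemma fineK_dom f x : proper_function f -> edom f x -> f x = (fine (f x))%:E.
Proof.
move=> [_ /(_ x)]; rewrite /edom /=.
by case: (f x).
Qed.

Lemma convex_dom f x y (t : R) : proper_function f -> econvex f ->
  edom f x -> edom f y -> 0 <= t <= 1 ->
  edom f (t *: x + (1 - t) *: y) /\
  fine (f (t *: x + (1 - t) *: y)) <= t * fine (f x) + (1 - t) * fine (f y).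
Proof.
move=> fp fc fx fy t01; have := fc x y t t01.
rewrite (fineK_dom fp fx) (fineK_dom fp fy) -!EFinM -EFinD => le.
have dom : edom f (t *: x + (1 - t) *: y) by apply: le_lt_trans le (ltry _).
by split => //; move: le; rewrite (fineK_dom fp dom) lee_fin.
Qed.

(** Closedness of the epigraph bounds f below by f(x1) - 1 on a ball around x1;
    along a ray from x1, convexity propagates this to a bound that decreases
    linearly. *)
Lemma cone_minorant f x1 : proper_closed_convex f -> edom f x1 ->
  exists2 K : R, 0 <= K &
    forall z, ((fine (f x1) - 1 - K * enorm (z - x1))%:E <= f z)%E.
Proof.
move=> [fp fcl fc] fx1.
have epi1 : ~ epigraph f (x1, fine (f x1) - 1).
  by rewrite /epigraph /= [f x1](fineK_dom fp fx1) lee_fin /=; lra.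
have oC : open (~` epigraph f) by apply: closed_openC.
have /nbhs_ballP[e /= e0 eC] := open_nbhs_nbhs (conj oC epi1).
exists (2 / e); first by rewrite divr_ge0// ltW.
have near z : enorm (z - x1) < e -> ((fine (f x1) - 1)%:E < f z)%E.
  move=> ze; rewrite ltNge; apply/negP; apply: (eC (z, fine (f x1) - 1)).
  split => /=; last exact: ballxx.
  rewrite -ball_normE /ball_ /=.
  by apply: le_lt_trans ze; rewrite -normrN opprB mx_norm_le_enorm.
move=> z; set N := enorm (z - x1).
have N0 : 0 <= N := enorm_ge0 _.
have [Ne|eN] := ltP N e.
  apply: le_trans (ltW (near z Ne)).
  by rewrite lee_fin lerBlDr lerDl mulr_ge0// divr_ge0// ltW.
have Ngt : 0 < N by apply: lt_le_trans eN.
have [fz|] := boolP (f z < +oo)%E; last by rewrite -leNgt leye_eq => /eqP ->; rewrite leey.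
set s := (e / 2) / N.
have s0 : 0 < s by rewrite !divr_gt0.
have s1 : s <= 1 by rewrite /s ler_pdivrMr// mul1r; lra.
have [|D le] := @convex_dom f z x1 s fp fc fz fx1; first by rewrite (ltW s0).
have := near (s *: z + (1 - s) *: x1).
have -> : s *: z + (1 - s) *: x1 - x1 = s *: (z - x1).
  by apply/rowP => i; rewrite !mxE; ring.
rewrite enormZ (gtr0_norm s0) -/N /s mulfVK ?gt_eqF// -/s.
have e2 : e / 2 < e by lra.
move=> /(_ e2); rewrite (fineK_dom fp D) lte_fin (fineK_dom fp fz) lee_fin => lt.
have {lt le} : -1 < s * (fine (f z) - fine (f x1)) by lra.
have -> : 2 / e * N = s^-1 by rewrite /s; field; rewrite !gt_eqF.
move=> h; have : - s^-1 < fine (f z) - fine (f x1).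
  by rewrite -(ltr_pM2l s0) mulrN mulfV ?gt_eqF.
lra.
Qed.

(** The quadratic term beats the linear minorant, so the part S of the epigraph
    below the level of x1 is compact. The continuous function
    r + (2t)^-1 |z - x|^2 of (z, r) attains its minimum on S, although f itself
    is only lower semicontinuous. *)
Lemma prox_exists f (t : R) x : proper_closed_convex f -> 0 < t ->
  exists p, argmin (fun z => (f z + ((2 * t)^-1 * enorm (z - x) ^+ 2)%:E)%E) p.
Proof.
move=> fcvx t0; have [fp fcl fc] := fcvx; have [[x1 fx1] _] := fp.
have [K K0 minor] := cone_minorant fcvx fx1.
set r1 := fine (f x1) in minor *.
pose k := (2 * t)^-1.
have k0 : 0 < k by rewrite invr_gt0 mulr_gt0.
pose q z := k * enorm (z - x) ^+ 2.
pose Q (u : 'rV[R]_n * R) := u.2 + q u.1.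
have qc : continuous q.
  by move=> z; exact: (cvgM (cvg_cst k) (@continuous_enorm_sqr _ _ x z)).
have Qc : continuous Q.
  move=> u; apply: (cvgD cvg_snd).
  exact: (@cvg_comp _ _ _ fst q _ _ _ cvg_fst (qc u.1)).
pose M := r1 + q x1.
pose c0 := `|M - r1 + 1 + K * enorm (x - x1)|.
pose B := K / k + c0 / k + 1.
have c00 : 0 <= c0 by exact: normr_ge0.
have kge0 : 0 <= k := ltW k0.
have B0 : 0 <= B by rewrite !addr_ge0// divr_ge0.
pose lo := r1 - 1 - K * enorm (x - x1) - K * B.
pose Z := [set z | enorm (z - x) ^+ 2 <= B ^+ 2].
pose S := ((Z `*` `[lo, M]%classic) `&` (epigraph f `&` [set u | Q u <= M])).
have Sc : compact S.
  apply: compact_closedI.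
    apply: compact_setX; last exact: segment_compact.
    apply: bounded_closed_compact.
      exists (B + `|x|); split; first exact: num_real.
      move=> M' BM z /= Zz; apply: le_trans (ltW BM).
      rewrite -[z in `|z|](subrK x); apply: le_trans (ler_normD _ _) _.
      rewrite lerD2r; apply: (le_trans (mx_norm_le_enorm _)).
      exact: enorm_le_sqr.
    apply: (@closed_comp _ _ (fun z => enorm (z - x) ^+ 2) [set r | r <= B ^+ 2]).
      by move=> z _; exact: continuous_enorm_sqr.
    exact: closed_le.
  apply: closedI => //.
  apply: (@closed_comp _ _ Q [set r | r <= M]); last exact: closed_le.
  by move=> u _; exact: Qc.
(* B was chosen so that k B = K + c0 + k: farther than B from x, the quadratic
   term exceeds what the minorant leaves below the level M. *)
have inS z : edom f z -> fine (f z) + q z <= M -> S (z, fine (f z)).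
  move=> fz le; have fE := fineK_dom fp fz.
  have := minor z; rewrite fE lee_fin => mz.
  have tri : enorm (z - x1) <= enorm (z - x) + enorm (x - x1).
    by rewrite (_ : z - x1 = (z - x) + (x - x1)) ?enormD// addrA subrK.
  have Kt := ler_wpM2l K0 tri.
  have zB : enorm (z - x) <= B.
    rewrite leNgt; apply/negP => Bz.
    have e1 : 1 <= enorm (z - x).
      by apply: le_trans (ltW Bz); rewrite lerDr addr_ge0// divr_ge0.
    have e0 : 0 < enorm (z - x) by lra.
    have : k * B * enorm (z - x) < q z.
      by rewrite /q expr2 mulrA ltr_pM2r// ltr_pM2l.
    have -> : k * B = K + c0 + k by rewrite /B; field; rewrite gt_eqF.
    have : c0 <= c0 * enorm (z - x) by rewrite ler_peMr.
    have : 0 < k * enorm (z - x) by rewrite mulr_gt0.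
    have := ler_norm (M - r1 + 1 + K * enorm (x - x1)); rewrite -/c0.
    move: Kt; rewrite mulrDr !mulrDl => *.
    lra.
  split; first split => /=.
  - by rewrite /Z /= ler_pXn2r ?nnegrE ?enorm_ge0.
  - rewrite in_itv/=; apply/andP; split; last first.
      by apply: le_trans le; rewrite lerDl mulr_ge0 ?sqr_ge0// ltW.
    have := ler_wpM2l K0 zB; rewrite /lo; move: Kt; rewrite mulrDr; lra.
  - by split => //=; rewrite /epigraph /= fE.
have [[p rp] /set_mem[_ [/= epi leM]] pmin] :
    exists2 u, u \in S & forall u', u' \in S -> Q u <= Q u'.
  apply: compact_EVT_min => //.
    by exists (x1, r1); exact: inS.
  exact: continuous_subspaceT.
exists p => w; rewrite -/k.
have [fw|] := boolP (f w < +oo)%E; last first.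
  by rewrite -leNgt leye_eq => /eqP ->; rewrite addye ?leey.
apply: (@le_trans _ _ (Q (p, rp))%:E).
  by rewrite /Q /= EFinD leeD.
rewrite (fineK_dom fp fw) -EFinD lee_fin -/(q w).
have [wM|/ltW] := leP (fine (f w) + q w) M; last exact: le_trans.
by apply: (pmin (w, fine (f w))); rewrite inE; exact: inS.
Qed.

(** A minimizer p of phi + k |. - x|^2 beats any w by k |w - p|^2: compare p with
    the points s w + (1 - s) p and let s tend to 0. *)
Lemma min_quadratic_growth (D : set 'rV[R]_n) (phi : 'rV[R]_n -> R) (k : R) x p w :
  0 <= k ->
  (forall s : R, 0 < s < 1 -> D (s *: w + (1 - s) *: p) /\
     phi (s *: w + (1 - s) *: p) <= s * phi w + (1 - s) * phi p) ->
  (forall z, D z -> phi p + k * enorm (p - x) ^+ 2 <= phi z + k * enorm (z - x) ^+ 2) ->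
  phi p + k * enorm (p - x) ^+ 2 + k * enorm (w - p) ^+ 2
    <= phi w + k * enorm (w - x) ^+ 2.
Proof.
move=> k0 cvx pmin.
set a := phi p + _; set b := phi w + _; set e := k * enorm (w - p) ^+ 2.
have e0 : 0 <= e by rewrite mulr_ge0 ?sqr_ge0.
have key s : 0 < s < 1 -> a + (1 - s) * e <= b.
  move=> s01; have [Ds le] := cvx s s01; have := pmin _ Ds.
  have -> : enorm (s *: w + (1 - s) *: p - x) ^+ 2 =
    s * enorm (w - x) ^+ 2 + (1 - s) * enorm (p - x) ^+ 2
      - s * (1 - s) * enorm (w - p) ^+ 2.
    rewrite !dotvE (dotvC x w) (dotvC x p) (dotvC p w); ring.
  move=> h; have {h}: s * (a + (1 - s) * e) <= s * b.
    by rewrite /a /b /e; move: h le; lra.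
  by rewrite ler_pM2l//; case/andP: s01.
rewrite leNgt; apply/negP => lt; move: lt key e0; clearbody a b e => lt key e0.
have [e00|e00] := eqVneq e 0.
  have h2 : 0 < (2^-1 : R) < 1.
    by rewrite invr_gt0 ltr0n invf_lt1 ?ltr0n// ltr1n.
  by have := key _ h2; move: lt; rewrite e00 mulr0; lra.
have egt : 0 < e by rewrite lt_neqAle eq_sym e00.
pose s := Num.min (1/2) ((a + e - b) / (2 * e)).
have abe : 0 < a + e - b by lra.
have s0 : 0 < s by rewrite lt_min !divr_gt0 ?mulr_gt0.
have s1 : s <= 1/2 by rewrite ge_min lexx.
have : s * e <= (a + e - b) / 2.
  have : s <= (a + e - b) / (2 * e) by rewrite ge_min lexx orbT.
  rewrite -(ler_pM2r egt) => /le_trans; apply.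
  by rewrite le_eqVlt; apply/orP; left; apply/eqP; field.
have s01 : 0 < s < 1 by apply/andP; split; lra.
by have := key s s01; lra.
Qed.

Lemma prox_spec f (t : R) x : proper_closed_convex f -> 0 < t ->
  edom f (prox t f x) /\
  forall w, edom f w ->
    fine (f (prox t f x)) + (2 * t)^-1 * enorm (prox t f x - x) ^+ 2
      + (2 * t)^-1 * enorm (w - prox t f x) ^+ 2
    <= fine (f w) + (2 * t)^-1 * enorm (w - x) ^+ 2.
Proof.
move=> fcvx t0; have [fp fcl fc] := fcvx.
have [p0 p0min] := prox_exists x fcvx t0.
have : argmin (fun z => (f z + ((2 * t)^-1 * enorm (z - x) ^+ 2)%:E)%E) (prox t f x).
  by rewrite /prox /argmin_pt; case: xgetP => [? -> //|/(_ p0)].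
move: (prox t f x) => p pmin.
have [[x1 fx1] _] := fp.
have dp : edom f p.
  rewrite /edom /= ltNge leye_eq; apply/negP => /eqP fpy.
  by have := pmin x1; rewrite fpy addye// (fineK_dom fp fx1) -EFinD leye_eq.
split=> // w dw; apply: (@min_quadratic_growth (edom f) (fine \o f)) => //.
- by rewrite invr_ge0 mulr_ge0// ltW.
- move=> s s01; apply: convex_dom => //.
  by case/andP: s01 => /ltW -> /ltW ->.
- move=> z dz /=; have := pmin z.
  by rewrite [f z](fineK_dom fp dz) [f p](fineK_dom fp dp) -!EFinD lee_fin.
Qed.

End Prox.

(** * First-order Taylor remainder of the inner map *)

Section Smooth.
Context {R : realType} {d m : nat}.
Implicit Types (c : 'rV[R]_d -> 'rV[R]_m).

Lemma is_derive_line c (y e : 'rV[R]_d) (s : R) (i : 'I_m) :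
  differentiable c (y + s *: e) ->
  is_derive s 1 (fun s : R => c (y + s *: e) 0 i) ((e *m jacobian c (y + s *: e)) 0 i).
Proof.
move=> dc; have dv : derivable c (y + s *: e) e by exact: diff_derivable.
have dE := deriveEjacobian e dc.
have quot :
  (fun h : R => h^-1 *: (((fun s : R => c (y + s *: e)) \o shift s) (h *: 1)
                           - c (y + s *: e)))
  = (fun h => h^-1 *: ((c \o shift (y + s *: e)) (h *: e) - c (y + s *: e))).
  apply/funext => h /=.
  have -> // : y + (h *: 1 + s) *: e = h *: e + (y + s *: e).
  by rewrite [h *: 1]mulr1 scalerDl addrCA.
have dl : derivable (fun s : R => c (y + s *: e)) s 1 by rewrite /derivable quot.
apply: DeriveDef; first by move/derivable_mxP: dl; apply.
have : 'D_1 (fun s : R => c (y + s *: e)) s = e *m jacobian c (y + s *: e).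
  by rewrite -dE /derive quot.
by rewrite (derive_mx dl) => /matrixP/(_ 0 i); rewrite mxE.
Qed.

(** With e = z - y and r the remainder itself, the mean value theorem is applied
    to the scalar function
    phi(s) = <r, c(y + s e)> - s <r, e nabla c(y)> - (beta/2) s^2 |r| |e|^2:
    its derivative is nonpositive on [0, 1], and phi(1) <= phi(0) reads
    |r|^2 <= (beta/2) |r| |e|^2. *)
Lemma taylor_remainder c (beta : R) (y z : 'rV[R]_d) :
  C1_smooth c -> jacobian_lipschitz beta c ->
  enorm (c z - (c y + (z - y) *m jacobian c y)) <= beta / 2 * enorm (z - y) ^+ 2.
Proof.
move=> [dc _] Jlip; set e := z - y; set r := c z - _.
have [r0|r0] := eqVneq (enorm r) 0.
  have := Jlip z y; have := opnorm_ge0 (jacobian c z - jacobian c y).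
  move=> h1 h2; have := le_trans h1 h2; rewrite -/e r0 => h3.
  by rewrite expr2 mulrA mulr_ge0 ?enorm_ge0//; lra.
have rgt : 0 < enorm r by rewrite lt_neqAle eq_sym r0 enorm_ge0.
pose D0 := dotv r (e *m jacobian c y).
pose k := beta / 2 * enorm r * enorm e ^+ 2.
pose ci (i : 'I_m) := fun s : R => c (y + s *: e) 0 i.
pose phi : R -> R := (\sum_(i < m) (r 0 i \*: ci i)) - D0 \*: id - k \*: (id ^+ 2).
pose dphi (s : R) : R := dotv r (e *m jacobian c (y + s *: e)) - D0 - k * (2 * s).
have dphiP s : is_derive s (1 : R) phi (dphi s).
  have di i : is_derive s (1 : R) (ci i) ((e *m jacobian c (y + s *: e)) 0 i).
    exact: is_derive_line.
  apply: is_derive_eq.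
  rewrite /dphi /dotv; congr (_ - _ - _).
    by rewrite /GRing.scale /= mulr1.
  by rewrite /GRing.scale /= mulr1 expr1.
have [|s s01] := @MVT R phi dphi 0 1 ltr01 (fun s _ => dphiP s).
  apply: continuous_subspaceT => s; apply: differentiable_continuous.
  by apply/derivable1_diffP; exact: ex_derive.
have phiE t : phi t = dotv r (c (y + t *: e)) - t * D0 - k * t ^+ 2.
  rewrite /phi /= !fctE /= fct_sumE /dotv /GRing.scale /=; congr (_ - _ - _).
  by rewrite mulrC.
have ye : y + e = z by rewrite /e addrC subrK.
rewrite !phiE scale0r scale1r addr0 subr0 mulr1 ye.
move: s01; rewrite in_itv /= => /andP[s0 s1].
have dle : dphi s <= 0.
  rewrite /dphi /D0 -dotvNr -dotvDr -mulmxBr.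
  have := cauchy_schwarz r (e *m (jacobian c (y + s *: e) - jacobian c y)).
  have h1 := enorm_mulmx (jacobian c (y + s *: e) - jacobian c y) e.
  have := Jlip (y + s *: e) y.
  have -> : y + s *: e - y = s *: e by rewrite addrC addKr.
  rewrite enormZ (gtr0_norm s0).
  move=> /(ler_wpM2r (enorm_ge0 e)) h2.
  have := ler_wpM2l (ltW rgt) (le_trans h1 h2).
  rewrite /k; lra.
rewrite mul0r expr0n /= mulr0 !subr0 mul1r expr1n mulr1 => E.
have : enorm r ^+ 2 <= k.
  have -> : enorm r ^+ 2 = dotv r (c z) - dotv r (c y) - D0.
    by rewrite enorm_sqr /D0 -!dotvNr -!dotvDr /r opprD addrA.
  by lra.
by rewrite /k mulrAC expr2 ler_pM2r.
Qed.

End Smooth.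

(** * Adding a finite continuous convex function *)

Section ConvexReal.
Context {R : realType} {n : nat}.
Implicit Types (g : 'rV[R]_n -> \bar R) (k : 'rV[R]_n -> R).

Definition real_convex k : Prop := forall x y (t : R), 0 <= t <= 1 ->
  k (t *: x + (1 - t) *: y) <= t * k x + (1 - t) * k y.

Lemma convex_function_real_convex k :
  convex_function [set: 'rV[R]_n] k -> real_convex k.
Proof.
move=> kc x y t /andP[t0 t1].
have := kc (Itv01 t0 t1) x y; rewrite !inE => /(_ Logic.I Logic.I).
by [].
Qed.

Lemma elipschitz_continuous (L : R) k : elipschitz L k -> continuous k.
Proof.
move=> kL x; apply/(@cvgrPdist_lt _ _ _ _ (nbhs_filter x)) => e e0.
have L1 : 0 < `|L| + 1 by rewrite ltr_pwDr.
have sq := @continuous_enorm_sqr R n x x.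
have E2 : 0 < (e / (`|L| + 1)) ^+ 2 by rewrite exprn_gt0// divr_gt0.
move/(@cvgrPdist_lt _ _ _ _ (nbhs_filter x)) : sq => /(_ _ E2); rewrite subrr enorm0 expr0n/=.
apply: filterS => z; rewrite sub0r normrN ger0_norm ?sqr_ge0//.
rewrite ltr_pXn2r ?nnegrE ?enorm_ge0 ?divr_ge0 ?(ltW e0) ?(ltW L1)//.
rewrite ltr_pdivlMr// => lt.
rewrite (le_lt_trans (kL _ _))// enormB (le_lt_trans _ lt)// mulrC.
by rewrite ler_wpM2l ?enorm_ge0// (le_trans (ler_norm L))// lerDl.
Qed.

Lemma edomD g k : edom (fun z => (g z + (k z)%:E)%E) = edom g.
Proof.
by apply/funext => z; rewrite /edom /=; case: (g z) => //= r; rewrite -EFinD !ltry.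
Qed.

Lemma proper_closed_convexD g k : proper_closed_convex g -> real_convex k -> continuous k ->
  proper_closed_convex (fun z => (g z + (k z)%:E)%E).
Proof.
move=> [[gd gp] gcl gc] kc kk; split.
- split; first by rewrite edomD.
  by move=> z; have := gp z; case: (g z) => //= r _; rewrite -EFinD ltNyr.
- rewrite /closed_function.
  have -> : epigraph (fun z => (g z + (k z)%:E)%E) =
      (fun u : 'rV[R]_n * R => (u.1, u.2 - k u.1)) @^-1` epigraph g.
    apply/seteqP; split => -[z r]; rewrite /epigraph /=.
      by rewrite EFinB leeBrDr.
    by rewrite EFinB leeBrDr.
  have shiftc : continuous (fun u : 'rV[R]_n * R => u.2 - k u.1).
    move=> u; apply: (cvgB cvg_snd).
    exact: (@cvg_comp _ _ _ fst k _ _ _ cvg_fst (kk u.1)).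
  apply: closed_comp => // u _.
  exact: (cvg_pair cvg_fst (shiftc u)).
- move=> x y t t01; have [t0 t1] := andP t01.
  apply: (@le_trans _ _ ((t%:E * g x + (1 - t)%:E * g y) + (t * k x + (1 - t) * k y)%:E)%E).
    by rewrite leeD ?gc// lee_fin kc.
  rewrite (EFinD (t * k x)) (EFinM t) (EFinM (1 - t)) !muleDr ?fin_num_adde_defl//.
  by rewrite addeACA.
Qed.

Lemma proper_closed_convex_EFin k : real_convex k -> continuous k ->
  proper_closed_convex (EFin \o k).
Proof.
move=> kc kk.
have -> : EFin \o k = (fun z => ((fun=> 0%E) z + (k z)%:E)%E).
  by apply/funext => z /=; rewrite add0e.
apply: proper_closed_convexD => //; split.
- by split; [exists 0; rewrite /edom /= ltry|move=> z; rewrite ltNyr].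
- rewrite /closed_function.
  have -> : epigraph (fun=> 0%E : \bar R) = (@snd 'rV[R]_n R) @^-1` [set r | 0 <= r].
    by apply/seteqP; split => -[z r] /=; rewrite /epigraph /= lee_fin.
  apply: closed_comp => [u _|]; first exact: cvg_snd.
  exact: closed_ge.
- by move=> x y t _; rewrite !mule0 adde0.
Qed.

End ConvexReal.

(** * The Moreau envelope *)

Section Moreau.
Context {R : realType} {m : nat}.
Variables (h : 'rV[R]_m -> R) (L nu : R).
Hypotheses (hc : real_convex h) (hL : elipschitz L h) (nu0 : 0 < nu).
Implicit Types (z w : 'rV[R]_m).

Let p z := prox nu (EFin \o h) z.

Definition moreau z : R := h (p z) + (2 * nu)^-1 * enorm (p z - z) ^+ 2.

Definition moreau_grad z : 'rV[R]_m := nu^-1 *: (z - p z).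

Lemma moreau_spec z w :
  moreau z + (2 * nu)^-1 * enorm (w - p z) ^+ 2 <= h w + (2 * nu)^-1 * enorm (w - z) ^+ 2.
Proof.
have [|_ /(_ w)] := @prox_spec _ _ (EFin \o h) nu z _ nu0.
  by apply: proper_closed_convex_EFin => //; exact: elipschitz_continuous hL.
by apply; rewrite /edom /= ltry.
Qed.

Let k := (2 * nu)^-1.

Let k0 : 0 < k. Proof. by rewrite invr_gt0 mulr_gt0. Qed.

Let nuk : nu^-1 = 2 * k.
Proof. by rewrite /k; field; rewrite gt_eqF. Qed.

Lemma moreau_le z : moreau z <= h z.
Proof.
have := moreau_spec z z; rewrite subrr enorm0 expr0n mulr0 addr0.
by apply: le_trans; rewrite lerDl mulr_ge0 ?sqr_ge0// ltW.
Qed.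

(** With r = |z - p(z)|: h(z) - h(p(z)) <= L r <= r^2/(2 nu) + L^2 nu/2. *)
Lemma moreau_ge z : h z <= moreau z + L ^+ 2 * nu / 2.
Proof.
have : h z - h (p z) <= L * enorm (z - p z) by apply: le_trans (ler_norm _) (hL _ _).
rewrite /moreau -/k enormB.
have : 0 <= k * (enorm (p z - z) - nu * L) ^+ 2 by rewrite mulr_ge0 ?sqr_ge0// ltW.
rewrite sqrrB !mulrDr mulrN /k.
have -> : (2 * nu)^-1 * (enorm (p z - z) * (nu * L) *+ 2) = L * enorm (p z - z).
  by field; rewrite gt_eqF.
have -> : (2 * nu)^-1 * (nu * L) ^+ 2 = L ^+ 2 * nu / 2 by field; rewrite gt_eqF.
lra.
Qed.

(** Upper bound of the smoothness inequality: the proximal point of z is a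
    competitor in the problem that defines the envelope at w. *)
Lemma moreau_upper z w :
  moreau w <= moreau z + dotv (moreau_grad z) (w - z) + (2 * nu)^-1 * enorm (w - z) ^+ 2.
Proof.
have := moreau_spec w (p z).
have : 0 <= k * enorm (p z - p w) ^+ 2 by rewrite mulr_ge0 ?sqr_ge0// ltW.
rewrite /moreau_grad /moreau -/k nuk.
move: (p z) (p w) => a b; rewrite !dotvE.
rewrite (dotvC w z) (dotvC z a) (dotvC w a) (dotvC w b).
lra.
Qed.

(** Test the growth inequality at p(z) with the point p(w); what remains is
    (2 nu)^-1 times the square of |(p(w) - w) + (z - p(z))|. *)
Lemma moreau_lower z w :
  moreau z + dotv (moreau_grad z) (w - z) <= moreau w.
Proof.
have := moreau_spec z (p w).
have : 0 <= k * enorm ((p w - w) + (z - p z)) ^+ 2 by rewrite mulr_ge0 ?sqr_ge0// ltW.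
rewrite /moreau_grad /moreau -/k nuk.
move: (p z) (p w) => a b; rewrite !dotvE.
rewrite (dotvC w z) (dotvC z a) (dotvC w a) (dotvC w b) (dotvC z b) (dotvC a b).
lra.
Qed.

End Moreau.

(** * One step of the accelerated proximal gradient method *)

Section Accelerated.
Context {R : realType} {d : nat}.
Variables (g : 'rV[R]_d -> \bar R) (gcvx : proper_closed_convex g).
Variables (f : 'rV[R]_d -> R) (Lf mu : R) (y : 'rV[R]_d).
Hypothesis mu0 : 0 < mu.

Definition smoothed z : R := fine (g z) + f z + mu / 2 * enorm (z - y) ^+ 2.

(** The quantity A (gap of x to w) + (1 + mu A)/2 |v - w|^2 does not increase,
    for every competitor w and not only for the minimizer. The reason is that
    v' minimizes
    a (f(yb) + <G, z - yb> + g(z) + mu/2 |z - y|^2) + (1 + mu A)/2 |z - v|^2,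
    which is (1 + mu (A + a))-strongly convex; completing the square turns this
    into the single proximal step of parameter t. The error Lf/2 |x' - yb|^2 of
    the linearization is absorbed because x' - yb = th (v' - v) and
    Lf a^2 <= (A + a) (1 + mu A). *)
Lemma accelerated_step (A a : R) (x v G : 'rV[R]_d) :
  let th := a / (A + a) in
  let yb := th *: v + (1 - th) *: x in
  let t := a / (1 + mu * (A + a)) in
  let v' := prox t g (t *: (mu *: y + ((1 + mu * A) / a) *: v - G)) in
  let x' := th *: v' + (1 - th) *: x in
  0 <= A -> 0 < a -> Lf * a ^+ 2 <= (A + a) * (1 + mu * A) ->
  edom g x -> edom g v ->
  (forall z, f z <= f yb + dotv G (z - yb) + Lf / 2 * enorm (z - yb) ^+ 2) ->
  (forall z, f yb + dotv G (z - yb) <= f z) ->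
  [/\ edom g v', edom g x' & forall w, edom g w ->
    (A + a) * (smoothed x' - smoothed w) + (1 + mu * (A + a)) / 2 * enorm (v' - w) ^+ 2
    <= A * (smoothed x - smoothed w) + (1 + mu * A) / 2 * enorm (v - w) ^+ 2].
Proof.
move=> th yb t v' x' A0 a0 La dx dv up lo.
have [gp gcl gc] := gcvx.
set s := A + a; set sg := 1 + mu * s.
have s0 : 0 < s by rewrite /s; lra.
have sg0 : 0 < sg by rewrite /sg addr_gt0// mulr_gt0.
have th0 : 0 < th by rewrite divr_gt0.
have th1 : th <= 1 by rewrite ler_pdivrMr// mul1r /s; lra.
have ths : th * s = a by rewrite /th mulfVK// gt_eqF.
have sA : s - a = A by rewrite /s addrK.
have t0 : 0 < t by rewrite divr_gt0.
pose q := t *: (mu *: y + ((1 + mu * A) / a) *: v - G).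
have [dv' spec] : _ /\ _ := prox_spec q gcvx t0; rewrite -/v' in dv' spec.
have [|dx' gx'] := @convex_dom _ _ g v' x th gp gc dv' dx; first by rewrite (ltW th0).
split=> // w dw.
have sq z : sg * dotv q z = a * mu * dotv y z + (1 + mu * A) * dotv v z - a * dotv G z.
  rewrite /q !dotvE /t -/s -/sg; field.
  by rewrite !gt_eqF.
have h1 : a * fine (g v') + sg / 2 * enorm (v' - q) ^+ 2 + sg / 2 * enorm (w - v') ^+ 2
   <= a * fine (g w) + sg / 2 * enorm (w - q) ^+ 2.
  have := ler_wpM2l (ltW a0) (spec w dw).
  have -> : (2 * t)^-1 = sg / (2 * a) by rewrite /t -/s -/sg; field; rewrite !gt_eqF.
  rewrite !mulrDr !mulrA.
  by have -> : a * sg / (2 * a) = sg / 2 by field; rewrite gt_eqF.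
have h2 : s * fine (g x') <= a * fine (g v') + A * fine (g x).
  by rewrite -sA -ths; have := ler_wpM2l (ltW s0) gx'; lra.
have h3 : s * enorm (x' - y) ^+ 2 <= A * enorm (x - y) ^+ 2 + a * enorm (v' - y) ^+ 2.
  have : 0 <= s * (th * (1 - th)) * enorm (x - v') ^+ 2.
    apply: mulr_ge0 (sqr_ge0 _); apply: mulr_ge0 (ltW s0) _.
    by apply: mulr_ge0 (ltW th0) _; rewrite subr_ge0.
  rewrite -sA -ths /x' !dotvE (dotvC x v') (dotvC y v') (dotvC y x); lra.
have xyb : x' - yb = th *: (v' - v).
  by apply/rowP => i; rewrite !mxE; ring.
have h4 : s * f x' <= s * f yb + A * dotv G (x - yb) + a * dotv G (v' - yb)
    + (1 + mu * A) / 2 * enorm (v' - v) ^+ 2.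
  have := ler_wpM2l (ltW s0) (up x').
  have : s * (Lf / 2 * enorm (x' - yb) ^+ 2) <= (1 + mu * A) / 2 * enorm (v' - v) ^+ 2.
    rewrite xyb enormZ exprMn real_normK ?num_real//.
    move: (enorm (v' - v) ^+ 2) (sqr_ge0 (enorm (v' - v))) => N N0.
    have -> : s * (Lf / 2 * (th ^+ 2 * N)) = (Lf * a ^+ 2) / s / 2 * N.
      by rewrite -ths; field; rewrite gt_eqF.
    apply: (ler_wpM2r N0); rewrite ler_pM2r ?invr_gt0// ler_pdivrMr//.
    by rewrite [leRHS]mulrC.
  rewrite -sA -ths /x' !dotvE; lra.
have h5 := ler_wpM2l A0 (lo x).
have h6 := ler_wpM2l (ltW a0) (lo w).
have mu2 : 0 <= mu / 2 by rewrite divr_ge0// ltW.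
move: h1 h2 (ler_wpM2l mu2 h3) h4 h5 h6 (sq v') (sq w); rewrite /smoothed /sg /s.
(* With their bodies hidden, the points are atoms for the expansion of the inner
   products; the inequality then follows by adding up the hypotheses. *)
clear; clearbody x' v' q yb.
rewrite !dotvE (dotvC w q) (dotvC v' q) (dotvC w v') (dotvC v v') (dotvC w v).
rewrite (dotvC w y) (dotvC v' y) (dotvC x' y) (dotvC x y).
lra.
Qed.

End Accelerated.

(** * The method as a program *)

(** Scalar registers: 0-3 hold L, beta, Nc, eps; 4 holds mu, 5 holds nu, 6 holds
    tau, 7 and 8 hold the increment a and the weight A of the accelerated method,
    9 is set to 1 on success, 11 holds a/(A + a). Registers of R^d: 0 is the
    outer iterate y, 1 and 2 are the inner iterates x and v, 3 and 4 are scratch.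
    Registers of R^m: 0 is c(y), 1 and 2 are scratch. *)

Definition sneg1 : sexpr := SSub (SNat 0) (SNat 1).
Definition vsub (u v : vexpr) : vexpr := VAdd u (VScale sneg1 v).

Definition prox_par : sexpr :=
  SDiv (SReg 7) (SAdd (SNat 1) (SMul (SReg 4) (SAdd (SReg 8) (SReg 7)))).

Definition seqs (l : seq method) : method := foldr Seq Skip l.

Definition gradient_block : method := seqs [::
  SetS 11 (SDiv (SReg 7) (SAdd (SReg 8) (SReg 7)));
  SetD 3 (VAdd (VScale (SReg 11) (VReg 2)) (VScale (SSub (SNat 1) (SReg 11)) (VReg 1)));
  SetD 4 (vsub (VReg 3) (VReg 0));
  EvalJ 1 0 4;
  SetM 1 (VAdd (VReg 0) (VReg 1));
  ProxH 2 (SReg 5) 1;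
  SetM 1 (VScale (SDiv (SNat 1) (SReg 5)) (vsub (VReg 1) (VReg 2)));
  EvalJT 4 0 1].

Definition update_block : method := seqs [::
  SetD 4 (VScale prox_par
    (vsub (VAdd (VScale (SReg 4) (VReg 0))
                (VScale (SDiv (SAdd (SNat 1) (SMul (SReg 4) (SReg 8))) (SReg 7)) (VReg 2)))
          (VReg 4)));
  ProxG 2 prox_par 4;
  SetD 1 (VAdd (VScale (SReg 11) (VReg 2)) (VScale (SSub (SNat 1) (SReg 11)) (VReg 1)));
  SetS 8 (SAdd (SReg 8) (SReg 7));
  SetS 7 (SMul (SReg 6) (SReg 8))].

Definition inner_step : method := Seq gradient_block update_block.

(** At A = 0 the guard holds, so the first increment 1/Lf is always taken; the
    later ones are tau A. *)
Definition inner_loop : method :=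
  While (SReg 8) (SDiv (SNat 16) (SReg 4)) inner_step.

Definition stop_or_move : method :=
  If (SMul (SNat 2) (SMul (SReg 4) (SSqrt (SDotD 3 3)))) (SReg 3)
    (SetS 9 (SNat 1)) (SetD 0 (VReg 1)).

Definition outer_step : method := seqs [::
  EvalC 0 0;
  SetD 1 (VReg 0);
  SetD 2 (VReg 0);
  SetS 8 (SNat 0);
  SetS 7 (SDiv (SReg 5) (SMul (SReg 2) (SReg 2)));
  inner_loop;
  SetD 3 (vsub (VReg 1) (VReg 0));
  stop_or_move].

Definition outer_loop : method := While (SReg 9) (SNat 0) outer_step.

Definition prox_linear_method : method := seqs [::
  SetS 4 (SMul (SReg 0) (SReg 1));
  SetS 5 (SDiv (SMul (SReg 3) (SReg 3))
               (SMul (SNat 256) (SMul (SMul (SReg 0) (SReg 0)) (SReg 4))));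
  SetS 6 (SDiv (SReg 3) (SMul (SNat 16) (SMul (SReg 2) (SReg 0))));
  outer_loop].

Section Runs.
Context {R : realType} {d m : nat}.
Variables (g : 'rV[R]_d -> \bar R) (h : 'rV[R]_m -> R)
  (c : 'rV[R]_d -> 'rV[R]_m).
Implicit Types s : state R d m.

Local Notation exec := (exec g h c).

Lemma exec_seqs0 M l s1 s2 s3 k :
  exec M s1 s2 0 -> exec (seqs l) s2 s3 k -> exec (seqs (M :: l)) s1 s3 k.
Proof. exact: exec_Seq. Qed.

Lemma exec_seqs1 M l s1 s2 s3 k :
  exec M s1 s2 1 -> exec (seqs l) s2 s3 k -> exec (seqs (M :: l)) s1 s3 k.+1.
Proof. exact: exec_Seq. Qed.

Definition mix (th : R) (x v : 'rV[R]_d) := th *: v + (1 - th) *: x.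

(** The gradient at z of w |-> moreau h nu (cy + (w - y) nabla c(y)). *)
Definition model_grad (nu : R) (y z : 'rV[R]_d) (cy : 'rV[R]_m) : 'rV[R]_d :=
  moreau_grad h nu (cy + (z - y) *m jacobian c y) *m (jacobian c y)^T.

Lemma exec_gradient_block s :
  let th := sreg s 7 / (sreg s 8 + sreg s 7) in
  let yb := mix th (dreg s 1) (dreg s 2) in
  0 < sreg s 5 ->
  exists s', [/\ exec gradient_block s s' 3,
    sreg s' = [eta sreg s with 11 |-> th],
    forall i, (i < 3)%N -> dreg s' i = dreg s i,
    mreg s' 0 = mreg s 0 &
    dreg s' 4 = model_grad (sreg s 5) (dreg s 0) yb (mreg s 0)].
Proof.
move=> th yb nu0; eexists; split.
- apply: exec_seqs0; first exact: exec_SetS.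
  apply: exec_seqs0; first exact: exec_SetD.
  apply: exec_seqs0; first exact: exec_SetD.
  apply: exec_seqs1; first exact: exec_EvalJ.
  apply: exec_seqs0; first exact: exec_SetM.
  apply: exec_seqs1; first exact: exec_ProxH.
  apply: exec_seqs0; first exact: exec_SetM.
  apply: exec_seqs1; first exact: exec_EvalJT.
  exact: exec_Skip.
- by [].
- by case=> [|[|[|i]]].
- by [].
- by rewrite /= !mulr0n !mulr1n !sub0r !scaleN1r div1r.
Qed.

Lemma exec_update_block s :
  let a := sreg s 7 in let A := sreg s 8 in let mu := sreg s 4 in
  let t := a / (1 + mu * (A + a)) in
  let v' := prox t g (t *: (mu *: dreg s 0 + ((1 + mu * A) / a) *: dreg s 2 - dreg s 4)) in
  0 < t ->
  exists s', [/\ exec update_block s s' 1,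
    sreg s' = [eta sreg s with 8 |-> A + a, 7 |-> sreg s 6 * (A + a)],
    dreg s' 0 = dreg s 0, mreg s' 0 = mreg s 0 &
    dreg s' 1 = mix (sreg s 11) (dreg s 1) v' /\ dreg s' 2 = v'].
Proof.
move=> a A mu t v' t0; eexists; split.
- apply: exec_seqs0; first exact: exec_SetD.
  apply: exec_seqs1; first exact: exec_ProxG.
  apply: exec_seqs0; first exact: exec_SetD.
  apply: exec_seqs0; first exact: exec_SetS.
  apply: exec_seqs0; first exact: exec_SetS.
  exact: exec_Skip.
- by apply/funext => i /=; case: (i =P 7%N) => [->|].
- by [].
- by [].
- by rewrite /= !mulr0n !mulr1n !sub0r !scaleN1r.
Qed.

Lemma exec_inner_step s :
  let a := sreg s 7 in let A := sreg s 8 in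
  let mu := sreg s 4 in let nu := sreg s 5 in
  let th := a / (A + a) in let t := a / (1 + mu * (A + a)) in
  let yb := mix th (dreg s 1) (dreg s 2) in
  let v' := prox t g (t *: (mu *: dreg s 0 + ((1 + mu * A) / a) *: dreg s 2
                            - model_grad nu (dreg s 0) yb (mreg s 0))) in
  0 < nu -> 0 < t ->
  exists s', [/\ exec inner_step s s' 4,
    sreg s' = [eta sreg s with 8 |-> A + a, 7 |-> sreg s 6 * (A + a), 11 |-> th],
    dreg s' 0 = dreg s 0, mreg s' 0 = mreg s 0 &
    dreg s' 1 = mix th (dreg s 1) v' /\ dreg s' 2 = v'].
Proof.
move=> a A mu nu th t yb v' nu0 t0.
have [s1 [e1 sE1 dE1 mE1 GE1]] := exec_gradient_block nu0.
have := @exec_update_block s1; rewrite sE1 GE1 !dE1 //= mE1 => /(_ t0).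
move=> [s2 [e2 sE2 dE2 mE2 xE2]].
by exists s2; split=> //; exact: exec_Seq e1 e2.
Qed.

End Runs.

(** * Convergence *)

Definition linearized {R : realType} {d m : nat} (c : 'rV[R]_d -> 'rV[R]_m)
  (y z : 'rV[R]_d) : 'rV[R]_m := c y + (z - y) *m jacobian c y.

Section Convergence.
Context {R : realType} {d m : nat}.
Variables (g : 'rV[R]_d -> \bar R) (h : 'rV[R]_m -> R)
  (c : 'rV[R]_d -> 'rV[R]_m) (L beta Nc eps : R).
Hypotheses (gcvx : proper_closed_convex g) (hconv : real_convex h) (hlip : elipschitz L h).
Hypotheses (cC1 : C1_smooth c) (clip : jacobian_lipschitz beta c).
Hypothesis cNc : forall x, edom g x -> opnorm (jacobian c x) <= Nc.
Hypotheses (L0 : 0 < L) (beta0 : 0 < beta) (Nc0 : 0 < Nc) (eps0 : 0 < eps).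
Implicit Types s : state R d m.

Let mu := L * beta.
Let nu := eps * eps / (256 * (L * L * mu)).
Let tau := eps / (16 * (Nc * L)).
Let Lf := Nc ^+ 2 / nu.

Let mu0 : 0 < mu. Proof. exact: mulr_gt0. Qed.
Let nu0 : 0 < nu. Proof. by rewrite divr_gt0 ?mulr_gt0 ?ltr0n. Qed.
Let tau0 : 0 < tau. Proof. by rewrite divr_gt0 ?mulr_gt0. Qed.
Let Lf0 : 0 < Lf. Proof. by rewrite divr_gt0 ?exprn_gt0. Qed.

Let Lftau : Lf * tau ^+ 2 = mu.
Proof. by rewrite /Lf /tau /nu /mu; field; rewrite !gt_eqF. Qed.

Let nuE : L ^+ 2 * nu = (eps / 16) ^+ 2 / mu.
Proof. by rewrite /nu /mu; field; rewrite !gt_eqF. Qed.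

Local Notation lin := (linearized c).

Definition composite_val (x : 'rV[R]_d) : R := fine (g x) + h (c x).

Lemma linearized_convex_comb y (t : R) x z :
  lin y (t *: x + (1 - t) *: z) = t *: lin y x + (1 - t) *: lin y z.
Proof.
rewrite /linearized !scalerDr addrACA -scalerDl (addrC t) subrK scale1r.
congr (_ + _); rewrite !scalemxAl -mulmxDl; congr (_ *m _).
by apply/rowP => i; rewrite !mxE; ring.
Qed.

Lemma linearized_diff y x z : lin y x - lin y z = (x - z) *m jacobian c y.
Proof. by rewrite /linearized opprD addrACA subrr add0r -mulmxBl opprB addrA subrK. Qed.

Lemma convex_linearized_loss y : real_convex (h \o lin y).
Proof. by move=> x z t t01 /=; rewrite linearized_convex_comb; exact: hconv. Qed.

Lemma continuous_linearized_loss y : continuous (h \o lin y).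
Proof.
apply: (@elipschitz_continuous _ _ (L * opnorm (jacobian c y))) => x z /=.
apply: (le_trans (hlip _ _)); rewrite linearized_diff -mulrA ler_pM2l//.
exact: enorm_mulmx.
Qed.

(** The prox-linear step is a proximal step of the function
    z |-> g(z) + h(linearization of c at y), itself proper, closed and convex. *)
Lemma prox_linear_spec y (p := prox_linear_step g h c mu^-1 y) :
  edom g p /\ forall w, edom g w ->
    fine (g p) + h (lin y p) + mu / 2 * enorm (p - y) ^+ 2 + mu / 2 * enorm (w - p) ^+ 2
    <= fine (g w) + h (lin y w) + mu / 2 * enorm (w - y) ^+ 2.
Proof.
have [gp _ _] := gcvx.
have Gp : proper_closed_convex (fun z => (g z + ((h \o lin y) z)%:E)%E).
  apply: proper_closed_convexD => //; first exact: convex_linearized_loss.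
  exact: continuous_linearized_loss.
have mui : 0 < mu^-1 by rewrite invr_gt0.
have := prox_spec y Gp mui; rewrite edomD.
have -> : (2 * mu^-1)^-1 = mu / 2 by field; rewrite gt_eqF.
move=> [dp spec]; split=> // w dw; have := spec w dw.
by rewrite (fineK_dom gp dp) (fineK_dom gp dw) /=.
Qed.

Let smoothed_loss y z := moreau h nu (lin y z).

(** Let D, E, S be mu times the distances |y - p|, |x - p|, |x - y|, where p is
    the prox-linear point. The relative gap and the strong convexity of the model
    give E <= D/4 + eps/16, so S and D are comparable. If S <= eps/2 then
    D <= 3/4 eps. If not, D >= 7/20 eps, and F(x) <= model(x) <= F(y) -
    (15/32 D^2 - (eps/16)^2/2)/mu is a decrease of at least eps^2/(20 mu). *)
Lemma prox_linear_progress y x :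
  edom g y -> edom g x ->
  (forall w, edom g w ->
     smoothed g (smoothed_loss y) mu y x - smoothed g (smoothed_loss y) mu y w
       <= mu / 32 * enorm (y - w) ^+ 2) ->
  if 2 * (mu * enorm (x - y)) <= eps
  then enorm (prox_gradient g h c mu^-1 y) <= eps
  else composite_val x <= composite_val y - eps ^+ 2 / (20 * mu).
Proof.
move=> dy dx near.
have [dp spec] := prox_linear_spec y.
set p := prox_linear_step g h c mu^-1 y in dp spec.
pose D := mu * enorm (y - p); pose E := mu * enorm (x - p); pose S := mu * enorm (x - y).
have D0 : 0 <= D by rewrite mulr_ge0 ?enorm_ge0// ltW.
have E0 : 0 <= E by rewrite mulr_ge0 ?enorm_ge0// ltW.
have sqmu z : mu * enorm z ^+ 2 = (mu * enorm z) ^+ 2 / mu.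
  by field; rewrite gt_eqF.
have near_p := near p dp; rewrite /smoothed in near_p.
have hx := moreau_ge hlip nu0 (lin y x).
have hp := moreau_le hconv hlip nu0 (lin y p).
rewrite nuE in hx.
have spec_x := spec x dx.
have spec_y := spec y dy.
have linyy : lin y y = c y by rewrite /linearized subrr mul0mx addr0.
rewrite linyy subrr enorm0 expr0n mulr0 addr0 in spec_y.
have EDle : E ^+ 2 <= (D / 4) ^+ 2 + (eps / 16) ^+ 2.
  rewrite -(ler_pM2r (_ : 0 < mu^-1)) ?invr_gt0//.
  have -> : E ^+ 2 / mu = mu * enorm (x - p) ^+ 2 by rewrite sqmu.
  have -> : ((D / 4) ^+ 2 + (eps / 16) ^+ 2) / mu =
     mu * enorm (y - p) ^+ 2 / 16 + (eps / 16) ^+ 2 / mu.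
    by rewrite sqmu -/D; field; rewrite gt_eqF.
  move: near_p spec_x hx hp; rewrite /smoothed_loss; lra.
have ED : E <= D / 4 + eps / 16.
  have W0 : 0 <= D / 4 + eps / 16 by apply: addr_ge0; rewrite divr_ge0// ltW.
  rewrite -(@ler_pXn2r _ 2%N)// ?nnegrE//.
  apply: (le_trans EDle); rewrite sqrrD addrAC lerDl mulrn_wge0//.
  by apply: mulr_ge0; rewrite divr_ge0// ltW.
have SD : D <= S + E.
  rewrite /D /S /E -mulrDr ler_pM2l//.
  have -> : y - p = (y - x) + (x - p) by rewrite addrA subrK.
  by rewrite (enormB x y) enormD.
have DS : S <= D + E.
  rewrite /D /S /E -mulrDr ler_pM2l// [leRHS]addrC.
  have -> : x - y = (x - p) + (p - y) by rewrite addrA subrK.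
  by rewrite (enormB y p) enormD.
have epos : 0 < eps := eps0.
rewrite -/S; case: ifPn => [Sle|].
  rewrite /prox_gradient invrK -/p enormZ gtr0_norm// -/D; lra.
rewrite -ltNge => Sgt.
have Dgt : 7 / 20 * eps <= D by lra.
have D2 : (7 / 20 * eps) ^+ 2 <= D ^+ 2 by rewrite ler_pXn2r ?nnegrE//; lra.
have tay : h (c x) <= h (lin y x) + mu / 2 * enorm (x - y) ^+ 2.
  have := le_trans (ler_norm _) (hlip (c x) (lin y x)).
  have := ler_wpM2l (ltW L0) (@taylor_remainder _ _ _ c beta y x cC1 clip).
  rewrite -/(lin y x) /mu; lra.
have decr : composite_val x <= composite_val y - (15 / 32 * D ^+ 2 - (eps / 16) ^+ 2 / 2) / mu.
  have -> : (15 / 32 * D ^+ 2 - (eps / 16) ^+ 2 / 2) / mu =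
      15 / 32 * (mu * enorm (y - p) ^+ 2) - (eps / 16) ^+ 2 / mu / 2.
    by rewrite sqmu -/D; field; rewrite gt_eqF.
  move: near_p spec_y hx hp tay; rewrite /smoothed_loss /composite_val (enormB p y); lra.
apply: (le_trans decr); rewrite lerD2l lerN2.
have -> : eps ^+ 2 / (20 * mu) = (eps ^+ 2 / 20) / mu by field; rewrite gt_eqF.
by rewrite ler_pM2r ?invr_gt0//; move: D2; rewrite !exprMn; have := sqr_ge0 eps; lra.
Qed.

(** The envelope is nu^-1-smooth, and nabla c(y) has norm at most Nc on dom g. *)
Lemma smoothed_loss_bounds y yb z : edom g y ->
  let G := model_grad h c nu y yb (c y) in
  smoothed_loss y yb + dotv G (z - yb) <= smoothed_loss y z /\
  smoothed_loss y z <= smoothed_loss y yb + dotv G (z - yb) + Lf / 2 * enorm (z - yb) ^+ 2.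
Proof.
move=> dy G.
have GE : dotv G (z - yb) = dotv (moreau_grad h nu (lin y yb)) (lin y z - lin y yb).
  by rewrite linearized_diff [RHS]dotvC dotv_mul_tr dotvC.
rewrite GE; split; first exact: (moreau_lower hconv hlip nu0).
apply: (le_trans (moreau_upper hconv hlip nu0 (lin y yb) (lin y z))); rewrite lerD2l.
have -> : Lf / 2 * enorm (z - yb) ^+ 2 = (2 * nu)^-1 * (Nc * enorm (z - yb)) ^+ 2.
  by rewrite /Lf; field; rewrite gt_eqF.
have le : enorm (lin y z - lin y yb) <= Nc * enorm (z - yb).
  rewrite linearized_diff (le_trans (enorm_mulmx _ _))// ler_wpM2r ?enorm_ge0//.
  exact: cNc.
apply: ler_wpM2l; first by rewrite invr_ge0; apply: mulr_ge0 (ltW nu0).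
by rewrite ler_pXn2r// nnegrE ?enorm_ge0//; apply: mulr_ge0 (enorm_ge0 _); exact: ltW.
Qed.

Definition params s : Prop :=
  [/\ sreg s 2 = Nc, sreg s 3 = eps, sreg s 4 = mu, sreg s 5 = nu & sreg s 6 = tau].

(** The last clause is the estimate of [accelerated_step] accumulated since the
    start A = 0, x = v = y. *)
Definition inner_inv y s : Prop :=
  let A := sreg s 8 in let a := sreg s 7 in
  [/\ params s, dreg s 0 = y /\ mreg s 0 = c y,
    [/\ 0 <= A, 0 < a & Lf * a ^+ 2 <= (A + a) * (1 + mu * A)],
    edom g (dreg s 1) /\ edom g (dreg s 2) &
    forall w, edom g w ->
      A * (smoothed g (smoothed_loss y) mu y (dreg s 1) - smoothed g (smoothed_loss y) mu y w)
        + (1 + mu * A) / 2 * enorm (dreg s 2 - w) ^+ 2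
      <= 2^-1 * enorm (y - w) ^+ 2].

(** The condition Lf a^2 <= (A + a) (1 + mu A) survives because tau^2 = mu/Lf. *)
Lemma inner_stepP y s : edom g y -> inner_inv y s ->
  exists s', [/\ exec g h c inner_step s s' 4, inner_inv y s',
    sreg s' 9 = sreg s 9, sreg s' 8 = sreg s 8 + sreg s 7
    & sreg s' 7 = tau * sreg s' 8].
Proof.
move=> dy [[p2 p3 p4 p5 p6] [yE cE] [A0 a0 Aa] [dx dv] lyap].
have s0 : 0 < sreg s 8 + sreg s 7 by rewrite ltr_wpDl.
have := @exec_inner_step R d m g h c s; rewrite p4 p5 yE cE => -[//||].
  by rewrite divr_gt0// addr_gt0// mulr_gt0.
move=> s' [e' sE dE mE [xE vE]].
have up z : _ := (@smoothed_loss_bounds y _ z dy).2.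
have lo z : _ := (@smoothed_loss_bounds y _ z dy).1.
have [dv' dx' lyap'] := accelerated_step gcvx y mu0 A0 a0 Aa dx dv (up _) (lo _).
exists s'; split=> //; rewrite ?sE ?p6//; split; rewrite ?sE ?dE ?mE ?xE ?vE//=.
- by rewrite /params sE /=.
- rewrite p6; split; [exact: ltW | exact: mulr_gt0 |].
  rewrite exprMn mulrA Lftau.
  move: (sreg s 8 + sreg s 7) s0 => A' A'0'.
  apply: (@le_trans _ _ (A' * (1 + mu * A'))).
    by rewrite mulrDr mulr1 expr2 mulrCA lerDr ltW.
  apply: ler_wpM2r; last by rewrite lerDl; apply: mulr_ge0; exact: ltW.
  by apply: addr_ge0 => //; apply: mulr_ge0; exact: ltW.
- by move=> w dw; apply: le_trans (lyap w dw); exact: lyap'.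
Qed.

Lemma inner_loopP y n s : edom g y -> inner_inv y s ->
  sreg s 7 = tau * sreg s 8 ->
  16 / mu < sreg s 8 * (1 + tau) ^+ n ->
  exists s' k, [/\ exec g h c inner_loop s s' k, inner_inv y s',
    sreg s' 9 = sreg s 9, 16 / mu < sreg s' 8 & (k <= 4 * n)%N].
Proof.
move=> dy; elim: n s => [|n IHn] s inv aE An.
  have [p _ _ _ _] := inv; have [_ _ p4 _ _] := p.
  rewrite mulr1 in An; exists s, 0%N; split => //.
  by apply: exec_WhileFalse; rewrite /= p4 -ltNge.
have [p _ _ _ _] := inv; have [_ _ p4 _ _] := p.
have [Ale|Agt] := leP (sreg s 8) (16 / mu); last first.
  exists s, 0%N; split => //.
  by apply: exec_WhileFalse; rewrite /= p4 -ltNge.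
have [s1 [e1 inv1 f1 A1 a1]] := inner_stepP dy inv.
have [|s2 [k [e2 inv2 f2 A2 k2]]] := IHn s1 inv1 a1.
  rewrite A1 aE; move: An; rewrite exprS mulrA.
  by have -> : sreg s 8 + tau * sreg s 8 = sreg s 8 * (1 + tau) by ring.
exists s2, (4 + k)%N; split => //.
- by apply: exec_WhileTrue e1 e2; rewrite /= p4.
- by rewrite f2.
- by rewrite mulnS leq_add2l.
Qed.

(** One basic operation for c(y), then at most n + 1 inner steps of four each. *)
Lemma outer_stepP n s :
  params s -> sreg s 9 = 0 -> edom g (dreg s 0) ->
  16 / mu < Lf^-1 * (1 + tau) ^+ n ->
  exists s' k, [/\ exec g h c outer_step s s' k, (k <= 4 * n + 5)%N, params s' &
    (sreg s' 9 = 1 /\ enorm (prox_gradient g h c mu^-1 (dreg s' 0)) <= eps) \/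
    [/\ sreg s' 9 = 0, edom g (dreg s' 0) &
      composite_val (dreg s' 0) <= composite_val (dreg s 0) - eps ^+ 2 / (20 * mu)]].
Proof.
move=> ps flag dy nP; set y := dreg s 0 in dy *.
have [p2 p3 p4 p5 p6] := ps.
pose s1 : state R d m :=
  sets (sets (setd (setd (setm s 0 (c y)) 1 y) 2 y) 8 0) 7 (nu / (Nc * Nc)).
have LfE : Lf^-1 = nu / (Nc * Nc) by rewrite /Lf; field; rewrite !gt_eqF.
have inv1 : inner_inv y s1.
  split => //=.
  - rewrite -LfE; split => //; first by rewrite invr_gt0.
    by rewrite add0r mulr0 addr0 mulr1 expr2 mulrA mulfV ?gt_eqF// mul1r.
  - by move=> w dw; rewrite mul0r add0r mulr0 addr0 mul1r.
have [s2 [e2 inv2 f2 A2 a2]] := inner_stepP dy inv1.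
rewrite /s1 /= add0r -LfE in A2.
have [|s3 [k [e3 inv3 f3 A3 k3]]] := @inner_loopP y n s2 dy inv2 a2; first by rewrite A2.
have e13 : exec g h c inner_loop s1 s3 (4 + k).
  apply: exec_WhileTrue e2 e3; rewrite /= p4.
  by rewrite divr_ge0// ltW.
have [ps3 [yE cE] _ [dx dv] lyap] := inv3.
have [q2 q3 q4 q5 q6] := ps3.
have flag3 : sreg s3 9 = 0 by rewrite f3 f2 /=.
pose x := dreg s3 1.
pose s4 := setd s3 3 (x - y).
(* A > 16/mu turns the invariant into the relative accuracy mu/32 |y - w|^2. *)
have near w : edom g w ->
     smoothed g (smoothed_loss y) mu y x - smoothed g (smoothed_loss y) mu y w
       <= mu / 32 * enorm (y - w) ^+ 2.
  move=> dw; have := lyap w dw; rewrite -/x.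
  set del := smoothed _ _ _ _ _ - _; set V := enorm (dreg s3 2 - w); set N := enorm _ ^+ 2.
  have A0 : 0 < sreg s3 8 by apply: lt_trans A3; rewrite divr_gt0.
  have V0 : 0 <= (1 + mu * sreg s3 8) / 2 * V ^+ 2.
    by rewrite mulr_ge0 ?sqr_ge0// divr_ge0// addr_ge0// mulr_ge0// ltW.
  have N0 : 0 <= N by exact: sqr_ge0.
  move=> le; have : sreg s3 8 * del <= 2^-1 * N by lra.
  rewrite -ler_pdivlMl// => /le_trans; apply.
  rewrite mulrA ler_wpM2r//.
  rewrite ler_pdivrMl// -(ler_pM2r (_ : 0 < 32 / mu)) ?divr_gt0//.
  have -> : sreg s3 8 * (mu / 32) * (32 / mu) = sreg s3 8 by field; rewrite gt_eqF.
  by have -> : 2^-1 * (32 / mu) = 16 / mu by [field; rewrite gt_eqF]; exact: ltW.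
have prog := prox_linear_progress dy dx near.
have run s5 : exec g h c stop_or_move s4 s5 0 -> exec g h c outer_step s s5 (4 + k).+1.
  move=> e5; apply: exec_seqs1; first exact: exec_EvalC.
  apply: exec_seqs0; first exact: exec_SetD.
  apply: exec_seqs0; first exact: exec_SetD.
  apply: exec_seqs0; first exact: exec_SetS.
  apply: exec_seqs0; first exact: exec_SetS.
  rewrite /= p5 p2 -[(4 + k)%N]addn0; apply: exec_Seq e13 _.
  apply: (@exec_seqs0 _ _ _ _ _ _ _ [:: stop_or_move] s3 s4).
    have -> : s4 = setd s3 3 (veval (dreg s3) s3 (vsub (VReg 1) (VReg 0))).
      by rewrite /s4 /= mulr0n mulr1n sub0r scaleN1r -/x yE.
    exact: exec_SetD.
  by apply: exec_seqs0 e5 _; exact: exec_Skip.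
have kle : ((4 + k).+1 <= 4 * n + 5)%N by rewrite -addSn addnC leq_add2r.
have guard : seval s4 (SMul (SNat 2) (SMul (SReg 4) (SSqrt (SDotD 3 3))))
    <= seval s4 (SReg 3) = (2 * (mu * enorm (x - y)) <= eps).
  by rewrite /= q4 q3.
have [Sle|Sgt] := boolP (2 * (mu * enorm (x - y)) <= eps).
  exists (sets s4 9 1), (4 + k).+1; split=> //.
  - apply: run; apply: exec_IfTrue; first by rewrite guard.
    exact: exec_SetS.
  - by left; split=> //=; rewrite yE; move: prog; rewrite Sle.
exists (setd s4 0 x), (4 + k).+1; split=> //.
- apply: run; apply: exec_IfFalse; first by rewrite guard.
  exact: exec_SetD.
- by right; split=> //=; move: prog; rewrite (negbTE Sgt).
Qed.

(** Each unsuccessful outer step uses up eps^2/(20 mu) of the gap to the lower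
    bound, so there are at most N of them. *)
Lemma outer_loopP n (N : nat) (inf : R) s :
  (forall z, edom g z -> inf <= composite_val z) ->
  params s -> sreg s 9 = 0 -> edom g (dreg s 0) ->
  16 / mu < Lf^-1 * (1 + tau) ^+ n ->
  composite_val (dreg s 0) - inf <= N%:R * (eps ^+ 2 / (20 * mu)) ->
  exists s' k, [/\ exec g h c outer_loop s s' k, (k <= N.+1 * (4 * n + 5))%N &
    enorm (prox_gradient g h c mu^-1 (dreg s' 0)) <= eps].
Proof.
move=> lb; elim: N s => [|N IHN] s ps flag dy nP gap;
  have [s1 [k1 [e1 k1le ps1 [[f1 G1]|[f1 d1 F1]]]]] := outer_stepP ps flag dy nP.
1,3: exists s1, (k1 + 0)%N; split=> //.
1,3: by apply: exec_WhileTrue e1 _; [rewrite /= flag |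
  apply: exec_WhileFalse; rewrite /= f1 -ltNge].
1,2: by rewrite addn0 (leq_trans k1le)// leq_pmull.
- have del : 0 < eps ^+ 2 / (20 * mu) by rewrite divr_gt0 ?exprn_gt0// mulr_gt0.
  by have := lb _ d1; rewrite mul0r in gap; lra.
have [|s2 [k2 [e2 k2le G2]]] := IHN s1 ps1 f1 d1 nP.
  move: gap; rewrite -natr1 mulrDl mul1r; lra.
exists s2, (k1 + k2)%N; split=> //.
  by apply: exec_WhileTrue e1 e2; rewrite /= flag.
by rewrite mulSn leq_add.
Qed.

Lemma method_run n (N : nat) (inf : R) x0 :
  (forall z, edom g z -> inf <= composite_val z) -> edom g x0 ->
  16 / mu < Lf^-1 * (1 + tau) ^+ n ->
  composite_val x0 - inf <= N%:R * (eps ^+ 2 / (20 * mu)) ->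
  exists x k, [/\ generates g h c prox_linear_method L beta Nc eps x0 x k,
    enorm (prox_gradient g h c mu^-1 x) <= eps & (k <= N.+1 * (4 * n + 5))%N].
Proof.
move=> lb dx0 nP gap.
pose s : state R d m := sets (sets (sets (init_state L beta Nc eps x0) 4 mu) 5 nu) 6 tau.
have [|||s' [k [e kle G]]] := @outer_loopP n N inf s lb _ _ _ nP gap => //.
exists (dreg s' 0), k; split=> //; exists s' => //.
do 3 (apply: exec_seqs0; first exact: exec_SetS).
by rewrite -[k]addn0; apply: exec_Seq e _; exact: exec_Skip.
Qed.

End Convergence.

(** * Iteration counts *)

(** Here (16 X)^-1 is tau, and 4096 X^2 = 16 Lf/mu is the factor by which the
    weight must grow from 1/Lf to 16/mu. Since tau <= 1 gives ln(1 + tau) >= tau/2, it is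
    enough that n >= (2/tau) ln(4096 X^2), and 4096 <= X gives ln(4096 X^2) <= 3 ln X. *)
Lemma inner_iterations {R : realType} (X : R) : 4096 <= X ->
  exists n : nat, 4096 * X ^+ 2 < (1 + (16 * X)^-1) ^+ n /\
    (4 * n + 5)%:R <= 400 * (X * ln X).
Proof.
move=> X4096.
have X0 : 0 < X by apply: lt_le_trans X4096; rewrite ltr0n.
have X2 : 2 <= X by apply: le_trans X4096; rewrite ler_nat.
pose t := (16 * X)^-1.
have t0 : 0 < t by rewrite invr_gt0 mulr_gt0.
have t1 : t <= 1.
  by rewrite invf_le1 ?mulr_gt0//; lra.
have lnt : t / 2 <= ln (1 + t).
  have h : 0 < 1 + t by lra.
  have : ln (1 + t)^-1 <= - (t / (1 + t)).
    rewrite [z in ln z](_ : _ = 1 + - (t / (1 + t))); last by field; rewrite gt_eqF.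
    apply: le_ln1Dx; rewrite ltrN2 ltr_pdivrMr//; lra.
  rewrite lnV// lerN2; apply: le_trans.
  by rewrite ler_pM2l// lef_pV2 ?posrE//; lra.
have lnX : 2^-1 <= ln X.
  have : ln X^-1 <= X^-1 - 1.
    rewrite [z in ln z](_ : _ = 1 + (X^-1 - 1)); last by rewrite addrC subrK.
    apply: le_ln1Dx.
    by have : 0 < X^-1 by [rewrite invr_gt0]; lra.
  rewrite lnV//; have : X^-1 <= 2^-1 by rewrite lef_pV2 ?posrE.
  lra.
have XlnX : 1 <= X * ln X.
  by have := ler_pM _ _ X2 lnX; rewrite mulfV//; apply.
have ln0 : 0 < 4096 * X ^+ 2 :> R by rewrite mulr_gt0 ?exprn_gt0 ?ltr0n.
have ln3 : ln (4096 * X ^+ 2) <= 3 * ln X.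
  have -> : 3 * ln X = ln (X ^+ 3) by rewrite lnXn// mulr_natl.
  rewrite ler_ln ?posrE ?exprn_gt0// [leRHS]exprS.
  by rewrite ler_pM2r ?exprn_gt0.
have ln0' : 0 <= ln (4096 * X ^+ 2).
  rewrite ln_ge0//; apply: mulr_ege1; first by rewrite ler1n.
  by apply: exprn_ege1; apply: le_trans X2; rewrite ler1n.
pose y := 2 / t * ln (4096 * X ^+ 2).
have y0 : 0 <= y by rewrite mulr_ge0// divr_ge0// ltW.
exists (Num.truncn y).+1; split.
  rewrite -ltr_ln ?posrE ?exprn_gt0 ?addr_gt0// lnXn ?addr_gt0//.
  have yn : y < (Num.truncn y).+1%:R by have /andP[] := truncn_itv y0.
  rewrite -[ltRHS]mulr_natl; apply: (@lt_le_trans _ _ ((Num.truncn y).+1%:R * (t / 2))).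
    have -> : ln (4096 * X ^+ 2) = y * (t / 2) by rewrite /y; field; rewrite gt_eqF.
    by rewrite ltr_pM2r ?divr_gt0.
  by rewrite ler_pM2l ?ltr0n.
have : (Num.truncn y)%:R <= y by have /andP[] := truncn_itv y0.
have : y <= 96 * (X * ln X).
  rewrite /y /t invrK.
  have -> : 96 * (X * ln X) = 2 * (16 * X) * (3 * ln X) by ring.
  by rewrite ler_pM2l// !mulr_gt0.
move: XlnX; rewrite natrD natrM -natr1; clear; lra.
Qed.

Theorem mainTheorem5 (R : realType) :
  exists (K C : R) (M : method), [/\ 0 < K, 0 < C &
    forall (d m : nat) (g : 'rV[R]_d -> \bar R) (h : 'rV[R]_m -> R)
      (c : 'rV[R]_d -> 'rV[R]_m) (L beta Nc eps : R) (x0 : 'rV[R]_d),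
    proper_function g -> closed_function g -> econvex g ->
    convex_function [set: 'rV[R]_m] h -> elipschitz L h ->
    C1_smooth c -> jacobian_lipschitz beta c ->
    (ereal_sup [set (opnorm (jacobian c x))%:E | x in edom g] <= Nc%:E)%E ->
    edom g x0 ->
    0 < eps ->
    let F := composite g h c in
    let infF := ereal_inf (range F) in
    (-oo < infF)%E ->
    K <= Nc -> K <= L -> K <= beta -> (K%:E <= F x0 - infF)%E -> K <= eps^-1 ->
    exists (x : 'rV[R]_d) (k : nat),
      [/\ generates g h c M L beta Nc eps x0 x k,
          enorm (prox_gradient g h c (L * beta)^-1 x) <= eps &
          k%:R <= C * (L ^+ 2 * beta * Nc * fine (F x0 - infF) / eps ^+ 3)
                    * ln (Nc * L / eps)]].
Proof.
(* K = 16 makes Nc L/eps at least 16^3 = 4096, as [inner_iterations] requires.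
   With X = Nc L/eps and Y = L beta (F(x0) - inf F)/eps^2 there are at most
   20 Y + 2 <= 21 Y outer steps, of at most 400 X ln X basic operations each. *)
exists 16, 8400, prox_linear_method; split; [by rewrite ltr0n | by rewrite ltr0n |].
move=> d m g h c L beta Nc eps x0 gp gcl gc hc hlip cC1 clip supNc dx0 eps0 F infF
  infy KN KL Kb KD Ke.
have L0 : 0 < L by apply: lt_le_trans KL; rewrite ltr0n.
have b0 : 0 < beta by apply: lt_le_trans Kb; rewrite ltr0n.
have N0 : 0 < Nc by apply: lt_le_trans KN; rewrite ltr0n.
have cNc x : edom g x -> opnorm (jacobian c x) <= Nc.
  move=> dx; rewrite -lee_fin; apply: le_trans supNc.
  by apply: ereal_sup_ubound; exists x.
have FE x : edom g x -> F x = (composite_val g h c x)%:E.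
  by move=> dx; rewrite /F /composite (fineK_dom gp dx).
have infle x : (infF <= F x)%E by apply: ereal_inf_lbound; exists x.
have infE : infF = (fine infF)%:E.
  rewrite fineK// fin_numE; apply/andP; split; first by rewrite gt_eqF.
  by rewrite lt_eqF// (le_lt_trans (infle x0))// FE// ltry.
set inf := fine infF in infE.
pose Delta := composite_val g h c x0 - inf.
have DE : fine (F x0 - infF) = Delta by rewrite infE FE.
have D16 : 16 <= Delta by move: KD; rewrite infE FE// -EFinB lee_fin.
rewrite DE.
pose X := Nc * L / eps.
have X4096 : 4096 <= X.
  have -> : 4096 = 16 * 16 * 16 :> R by rewrite -!natrM.
  by apply: ler_pM => //; exact: ler_pM.
have X0 : 0 < X by rewrite divr_gt0 ?mulr_gt0.
have [n [nX nle]] := inner_iterations X4096.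
pose Y := L * beta * Delta / eps ^+ 2.
have ge1 r : 16 <= r -> 1 <= r by apply: le_trans; rewrite ler1n.
have Y2 : 2 <= Y.
  apply: (@le_trans _ _ Delta); first by apply: le_trans D16; rewrite ler_nat.
  have -> : Y = L * beta * (eps^-1 * eps^-1) * Delta.
    by rewrite /Y; field; rewrite gt_eqF.
  rewrite ler_peMl//; first by apply: le_trans D16.
  by apply: mulr_ege1; apply: mulr_ege1; exact: ge1.
pose N := (Num.truncn (20 * Y)).+1.
have Y0 : 0 <= 20 * Y by rewrite mulr_ge0// (le_trans _ Y2).
have /andP[Nlo Nhi] := truncn_itv Y0.
have lb z : edom g z -> inf <= composite_val g h c z.
  by move=> dz; rewrite -lee_fin -FE// -infE.
have hc' := convex_function_real_convex hc.
have [||x [k [gen G kle]]] := method_run (And3 gp gcl gc) hc' hlip cC1 clip cNc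
    L0 b0 N0 eps0 (n := n) (N := N) lb dx0.
- have -> : eps / (16 * (Nc * L)) = (16 * X)^-1.
    by rewrite /X; field; rewrite !gt_eqF.
  have -> : 16 / (L * beta) =
      (Nc ^+ 2 / (eps * eps / (256 * (L * L * (L * beta)))))^-1 * (4096 * X ^+ 2).
    by rewrite /X; field; rewrite !gt_eqF.
  rewrite ltr_pM2l; first exact: nX.
  by rewrite invr_gt0 !(divr_gt0, mulr_gt0, exprn_gt0) ?ltr0n.
- rewrite -/Delta.
  have -> : Delta = 20 * Y * (eps ^+ 2 / (20 * (L * beta))).
    by rewrite /Y; field; rewrite !gt_eqF.
  by rewrite ler_pM2r ?(ltW Nhi)// !(divr_gt0, mulr_gt0, exprn_gt0).
exists x, k; split=> //.
have -> : 8400 * (L ^+ 2 * beta * Nc * Delta / eps ^+ 3) * ln (Nc * L / eps) =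
    (21 * Y) * (400 * (X * ln X)).
  by rewrite /Y -/X {2}/X; field; rewrite gt_eqF.
apply: (@le_trans _ _ (N.+1 * (4 * n + 5))%N%:R); first by rewrite ler_nat.
rewrite natrM; apply: ler_pM => //.
move: Nlo Y2; rewrite /N -!natr1; clear; lra.
Qed.
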